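(* Let $\Pi$ be a glueable abstract pattern space over $(X,\Gamma)$. Assume the action of $\Gamma$ on $X$ is proper. Let $\mathcal{P}\in\Pi$ and assume that $\mathcal{P}$ has finite local complexity (FLC). Then the continuous hull $X_{\mathcal{P}}$ is compact.
   Context: Setting. $X$ is a nonempty proper metric space (closed balls are compact); $B(x,r)$ denotes the closed ball. $\Gamma$ is a group with a left-invariant proper metric $\rho_\Gamma$, and $\Gamma$ is a topological group for the metric topology. $\Gamma$ acts on $X$ by isometries and the action map $\Gamma\times X\to X$ is (jointly) continuous. The action is proper if the map $\Gamma\times X\to X\times X$, $(\gamma,x)\mapsto(\gamma x,x)$, is proper. $\mathrm{Cl}(X)$ is the set of closed subsets of $X$, $\mathrm{Cpt}(X)$ the set of compact subsets of $X$, and $\mathscr{V}$ the set of compact neighborhoods of the identity $e\in\Gamma$. Abstract pattern spaces. An abstract pattern space over $X$ is a nonempty set $\Pi$ with a map (cutting-off operation) $\Pi\times \mathrm{Cl}(X)\to\Pi$, $(\mathcal{P},C)\mapsto\mathcal{P}\wedge C$, such that (1) $(\mathcal{P}\wedge C_1)\wedge C_2=\mathcal{P}\wedge(C_1\cap C_2)$ for all $\mathcal{P}\in\Pi$ and $C_1,C_2\in\mathrm{Cl}(X)$; (2) for every $\mathcal{P}\in\Pi$ there is a (necessarily unique) closed set, denoted $\operatorname{supp}\mathcal{P}$, such that for all $C\in\mathrm{Cl}(X)$: $\mathcal{P}\wedge C=\mathcal{P}\iff C\supset\operatorname{supp}\mathcal{P}$. It is an abstract pattern space over $(X,\Gamma)$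 if moreover $\Gamma$ acts on $\Pi$ and $(\gamma\mathcal{P})\wedge(\gamma C)=\gamma(\mathcal{P}\wedge C)$ for all $\mathcal{P}\in\Pi$, $C\in\mathrm{Cl}(X)$, $\gamma\in\Gamma$. Elements of $\Pi$ are called abstract patterns. Order and gluing. $\mathcal{P}\geq\mathcal{Q}$ means $\mathcal{P}\wedge\operatorname{supp}\mathcal{Q}=\mathcal{Q}$; this is a partial order on $\Pi$. $\bigvee\Xi$ denotes the supremum of $\Xi\subset\Pi$ for this order, when it exists. Two elements $\mathcal{P},\mathcal{Q}\in\Pi$ are compatible if some $\mathcal{R}\in\Pi$ satisfies $\mathcal{R}\geq\mathcal{P}$ and $\mathcal{R}\geq\mathcal{Q}$. A subset $\Xi\subset\Pi$ is pairwise compatible if any two elements of $\Xi$ are compatible. For $C\in\mathrm{Cl}(X)$ put $\Xi\wedge C=\{\mathcal{P}\wedge C\mid\mathcal{P}\in\Xi\}$. $\Xi$ is locally finite if $\Xi\wedge B(x,r)$ is finite for all $x\in X$, $r>0$. $\Pi$ is glueable if for every locally finite and pairwise compatible $\Xi\subset\Pi$ (including $\Xi=\emptyset$) the supremum $\bigvee\Xi$ exists in $\Pi$ and $\bigvee(\Xi\wedge C)=(\bigvee\Xi)\wedge C$ for all $C\in\mathrm{Cl}(X)$. Local matching structure. For $K\in\mathrm{Cpt}(X)$ and $V\in\mathscr{V}$ let $\mathcal{U}_{K,V}=\{(\mathcal{P},\mathcal{Q})\in\Pi\times\Pi\mid\exists\gamma\in V:\ \mathcal{P}\wedge K=(\gamma\mathcal{Q})\wedge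 K\}$. These sets form a fundamental system of entourages of a uniform structure on $\Pi$, the local matching uniform structure; the induced topology is the local matching topology. Hull and FLC. The continuous hull of $\mathcal{P}\in\Pi$ is $X_{\mathcal{P}}=\overline{\{\gamma\mathcal{P}\mid\gamma\in\Gamma\}}$, the closure being taken in $\Pi$ with respect to the local matching topology. $\mathcal{P}$ has finite local complexity (FLC) if for every compact $K\subset X$ the set $\{(\gamma\mathcal{P})\wedge K\mid\gamma\in\Gamma\}$ is finite modulo the action of $\Gamma$ on $\Pi$, i.e. its elements lie in finitely many $\Gamma$-orbits. Compact means that every open cover has a finite subcover. *)

(* Defs.v *)
From HB Require Import structures.
From mathcomp Require Import all_boot all_order all_algebra.
From mathcomp Require Import all_classical all_reals all_analysis.

Set Implicit Arguments.
Unset Strict Implicit.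
Unset Printing Implicit Defensive.

Import Order.TTheory GRing.Theory Num.Theory.

Local Open Scope classical_set_scope.
Local Open Scope ring_scope.

(* The library's closed_ball is the closure of the open ball, which in a
   general metric space is smaller than this set. *)
Definition cball (R : numDomainType) (T : metricType R) (x : T) (r : R) : set T :=
  [set y | mdist x y <= r].

HB.mixin Record Metric_isProper (R : numDomainType) T & Metric R T := {
  cball_compact : forall (x : T) (r : R), compact (cball x r)
}.

#[short(type="properMetricType")]
HB.structure Definition ProperMetric (R : numDomainType) :=
  {T of Metric R T & Metric_isProper R T}.

HB.mixin Record isLeftInvariantTopGroup (R : numDomainType) G
    & Group G & Metric R G := {
  mdist_mull : forall g x y : G, mdist (g * x)%g (g * y)%g = mdist x y;
  mulg_continuous : continuous (fun xy : G * G => (xy.1 * xy.2)%g);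
  invg_continuous : continuous (fun x : G => x^-1%g)
}.

#[short(type="properMetricGroupType")]
HB.structure Definition ProperMetricGroup (R : numDomainType) :=
  {G of Group G & ProperMetric R G & isLeftInvariantTopGroup R G}.

Lemma metric_compact_closed (R : realType) (T : metricType R) (K : set T) :
  compact K -> closed K.
Proof. by apply: compact_closed; exact: metric_hausdorff. Qed.

Record isometric_action (R : realType) (G : properMetricGroupType R)
    (X : properMetricType R) := IsometricAction {
  act :> G -> X -> X;
  act1 : forall x, act 1%g x = x;
  actM : forall g h x, act (g * h)%g x = act g (act h x);
  act_isometry : forall g x y, mdist (act g x) (act g y) = mdist x y;
  act_continuous : continuous (fun gx : G * X => act gx.1 gx.2)
}.

Definition proper_map (S T : topologicalType) (f : S -> T) : Prop :=
  forall K : set T, compact K -> compact (f @^-1` K).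

Definition proper_action (R : realType) (G : properMetricGroupType R)
    (X : properMetricType R) (a : isometric_action G X) : Prop :=
  proper_map (fun gx : G * X => (a gx.1 gx.2, gx.2)).

(* cutoff is total on sets, but only its values on closed sets are specified
   or used. A closed set satisfying cutoff_suppP is unique, so supp carries no
   additional information. *)
Record pattern_space (R : realType) (X : metricType R) := PatternSpace {
  pattern :> Type;
  pattern_nonempty : inhabited pattern;
  cutoff : pattern -> set X -> pattern;
  supp : pattern -> set X;
  cutoffI : forall P C1 C2, closed C1 -> closed C2 ->
    cutoff (cutoff P C1) C2 = cutoff P (C1 `&` C2);
  supp_closed : forall P, closed (supp P);
  cutoff_suppP : forall P C, closed C -> cutoff P C = P <-> supp P `<=` C
}.

Record group_pattern_space (R : realType) (G : properMetricGroupType R)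
    (X : properMetricType R) (a : isometric_action G X) := GroupPatternSpace {
  base_space :> pattern_space X;
  pact : G -> base_space -> base_space;
  pact1 : forall P, pact 1%g P = P;
  pactM : forall g h P, pact (g * h)%g P = pact g (pact h P);
  pact_cutoff : forall g P C, closed C ->
    cutoff (pact g P) (a g @` C) = pact g (cutoff P C)
}.

Section order.
Context (R : realType) (X : metricType R) (Pi : pattern_space X).

HB.instance Definition _ := gen_eqMixin (pattern Pi).
HB.instance Definition _ := gen_choiceMixin (pattern Pi).

Definition pattern_le (Q P : pattern Pi) : bool := cutoff P (supp Q) == Q.

Lemma cutoff_supp (P : Pi) : cutoff P (supp P) = P.
Proof. by apply/cutoff_suppP => //; exact: supp_closed. Qed.

Lemma pattern_le_refl : reflexive pattern_le.
Proof. by move=> P; apply/eqP; exact: cutoff_supp. Qed.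

Lemma pattern_le_anti : antisymmetric pattern_le.
Proof.
move=> P Q /andP[/eqP QP /eqP PQ].
rewrite -[LHS]QP -{1}PQ cutoffI; try exact: supp_closed.
by rewrite setIC -cutoffI ?cutoff_supp ?PQ //; exact: supp_closed.
Qed.

Lemma pattern_le_supp (Q P : Pi) : pattern_le Q P -> supp Q `<=` supp P.
Proof.
move=> /eqP QP; apply/cutoff_suppP; first exact: supp_closed.
rewrite -QP cutoffI; try exact: supp_closed.
by rewrite setIC -cutoffI ?cutoff_supp //; exact: supp_closed.
Qed.

Lemma pattern_le_trans : transitive pattern_le.
Proof.
move=> Q P S PQ QS; have sPQ := pattern_le_supp PQ.
move/eqP: PQ => PQ; move/eqP: QS => QS; apply/eqP.
rewrite -[RHS]PQ -{1}QS cutoffI; try exact: supp_closed.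
by rewrite (setIidr sPQ).
Qed.

End order.

Fact pattern_display : Order.disp_t. Proof. exact: Order.Disp tt tt. Qed.

HB.instance Definition _ (R : realType) (X : metricType R)
    (Pi : pattern_space X) :=
  Order.Le_isPOrder.Build pattern_display (pattern Pi)
    (@pattern_le_refl R X Pi) (@pattern_le_anti R X Pi)
    (@pattern_le_trans R X Pi).

Lemma pattern_leE (R : realType) (X : metricType R) (Pi : pattern_space X)
  (P Q : Pi) : (Q <= P)%O <-> cutoff P (supp Q) = Q.
Proof. by split=> /eqP. Qed.

Section gluing.
Context (R : realType) (X : metricType R) (Pi : pattern_space X).

Definition compatible (P Q : Pi) : Prop :=
  exists S : Pi, (P <= S)%O /\ (Q <= S)%O.

Definition pairwise_compatible (Xi : set Pi) : Prop :=
  forall P Q, Xi P -> Xi Q -> compatible P Q.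

Definition set_cutoff (Xi : set Pi) (C : set X) : set Pi :=
  [set cutoff P C | P in Xi].

Definition loc_finite (Xi : set Pi) : Prop :=
  forall (x : X) (r : R), 0 < r -> finite_set (set_cutoff Xi (cball x r)).

(* supremums A is the set of least upper bounds of A, which has at most one
   element. *)
Definition glueable : Prop :=
  forall Xi : set Pi, loc_finite Xi -> pairwise_compatible Xi ->
    exists2 S : Pi, supremums Xi S &
      forall C, closed C -> supremums (set_cutoff Xi C) (cutoff S C).

End gluing.

Definition compact_nbhs1 (R : realType) (G : properMetricGroupType R) :
    set (set G) :=
  [set V | compact V /\ nbhs (1%g : G) V].

Section local_matching.
Context (R : realType) (G : properMetricGroupType R) (X : properMetricType R).
Context (a : isometric_action G X) (Pi : group_pattern_space a).

Definition match_on (K : set X) (V : set G) : set (Pi * Pi) :=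
  [set PQ | exists2 g, V g & cutoff PQ.1 K = cutoff (pact g PQ.2) K].

Definition match_entourage : set_system (Pi * Pi) :=
  filter_from [set KV : set X * set G | compact KV.1 /\ compact_nbhs1 KV.2]
    (fun KV => match_on KV.1 KV.2).

Lemma compact_nbhs1_sub (U : set G) : nbhs (1%g : G) U ->
  exists2 V, compact_nbhs1 V & V `<=` U.
Proof.
move=> /nbhs_ballP[e /= e0 eU]; exists (cball 1%g (e / 2)).
  split; first exact: cball_compact.
  apply/nbhs_ballP; exists (e / 2); first by rewrite /= divr_gt0.
  by move=> x; rewrite ballEmdist => /ltW.
move=> x /= xe; apply: eU; rewrite ballEmdist /=; apply: le_lt_trans xe _.
by rewrite ltr_pdivrMr // ltr_pMr // ltr1n.
Qed.

Lemma cutoff_sub (P Q : Pi) (K K' : set X) : closed K -> closed K' ->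
  K `<=` K' -> cutoff P K' = cutoff Q K' -> cutoff P K = cutoff Q K.
Proof.
by move=> cK cK' sK PQ; rewrite -(setIidr sK) -!cutoffI // PQ.
Qed.

Lemma match_onS (K K' : set X) (V V' : set G) : closed K -> closed K' ->
  K `<=` K' -> V' `<=` V -> match_on K' V' `<=` match_on K V.
Proof.
move=> cK cK' sK sV [P Q] [g /sV Vg PQ]; exists g => //.
exact: cutoff_sub sK PQ.
Qed.

Lemma compact_actV (V : set G) (K : set X) : compact V -> compact K ->
  compact [set a g^-1%g x | g in V & x in K].
Proof.
move=> cV cK.
have -> : [set a g^-1%g x | g in V & x in K] =
    (fun gx : G * X => a gx.1^-1%g gx.2) @` (V `*` K).
  apply/seteqP; split=> [_ [g Vg [x Kx <-]]|_ [[g x] [/= Vg Kx] <-]].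
    by exists (g, x).
  by exists g => //; exists x.
apply: continuous_compact; last exact: compact_setX.
apply: continuous_subspaceT => -[g x].
apply: (@continuous_comp _ _ _ (fun gx : G * X => (gx.1^-1%g, gx.2))
  (fun gx : G * X => a gx.1 gx.2)); last exact: act_continuous.
apply: cvg_pair => /=; last exact: cvg_snd.
by apply: (@cvg_comp _ _ _ fst (fun h : G => h^-1%g) _ (nbhs g));
  [exact: cvg_fst|exact: invg_continuous].
Qed.

Lemma cutoff_pact (g : G) (P Q : Pi) (K K' : set X) : closed K -> compact K' ->
  (forall x, K x -> K' (a g^-1%g x)) ->
  cutoff P K' = cutoff Q K' -> cutoff (pact g P) K = cutoff (pact g Q) K.
Proof.
move=> cK cK' KK' PQ.
have cgK' : closed (a g @` K').
  apply: metric_compact_closed; apply: continuous_compact => //.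
  apply: continuous_subspaceT => x.
  apply: (@continuous_comp _ _ _ (fun x => (g, x))
    (fun gx : G * X => a gx.1 gx.2)); last exact: act_continuous.
  by apply: cvg_pair => //=; exact: cvg_cst.
apply: (@cutoff_sub _ _ _ (a g @` K')) => //.
  by move=> x /KK' ?; exists (a g^-1%g x) => //; rewrite -actM mulgV act1.
by rewrite !pact_cutoff ?PQ //; exact: metric_compact_closed.
Qed.

Lemma match_entourage_filter : Filter match_entourage.
Proof.
apply: filter_from_filter.
  have [V VV _] := compact_nbhs1_sub (@filterT _ (nbhs (1%g : G)) _).
  by exists (set0, V); split=> //; exact: compact0.
move=> [K V] [K' V'] /= [cK [cV nV]] [cK' [cV' nV']].
exists (K `|` K', V `&` V') => /=.
  split; first exact: compactU.
  split; last exact: filterI.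
  by apply: compact_closedI => //; exact: metric_compact_closed.
have cKK' : closed (K `|` K') by apply: closedU; exact: metric_compact_closed.
rewrite subsetI; split; apply: match_onS => //; try exact: metric_compact_closed.
Qed.

Lemma match_entourage_diagonal A : match_entourage A -> diagonal `<=` A.
Proof.
move=> -[[K V] /= [_ [_ nV]] KVA] [P Q] PQ; apply: KVA; exists 1%g.
  exact: nbhs_singleton nV.
by rewrite pact1 [in LHS](PQ : P = Q).
Qed.

Lemma match_entourage_inv A : match_entourage A -> match_entourage A^-1%relation.
Proof.
move=> -[[K V] /= [cK [cV nV]] KVA].
have /compact_nbhs1_sub[W [cW nW] WV] : nbhs (1%g : G) [set g | V g^-1%g].
  by apply: invg_continuous; rewrite invg1.
set K' := [set a g^-1%g x | g in [set g^-1%g | g in W] & x in K].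
have cK' : compact K'.
  apply: compact_actV => //; apply: continuous_compact => //.
  by apply: continuous_subspaceT; exact: invg_continuous.
exists (K', W) => //.
move=> [P Q] [g Wg /= PQ]; apply: KVA; exists g^-1%g; first exact: WV.
rewrite /= -[in LHS](pact1 Q) -(mulVg g) pactM; apply/esym.
apply: (cutoff_pact _ cK' _ PQ); first exact: metric_compact_closed.
by move=> x Kx; exists g^-1%g; [exists g|exists x].
Qed.

Lemma match_entourage_split A : match_entourage A ->
  exists2 B, match_entourage B & (B \; B `<=` A)%relation.
Proof.
move=> -[[K V] /= [cK [cV nV]] KVA].
have : nbhs ((1%g, 1%g) : G * G) [set gh | V (gh.1 * gh.2)%g].
  by apply: (@mulg_continuous _ G (1%g, 1%g)); rewrite /= mulg1.
case=> -[U1 U2] /= [nU1 nU2] UV.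
have [W [cW nW] WU] := compact_nbhs1_sub (filterI nU1 nU2).
set K' := K `|` [set a g^-1%g x | g in W & x in K].
have cK' : compact K' by apply: compactU => //; exact: compact_actV.
exists (match_on K' W); first by exists (K', W).
move=> [P Q] /= [S [g Wg /= PS] [h Wh /= SQ]]; apply: KVA; exists (g * h)%g.
  by apply: (UV (g, h)); split; [exact: (WU _ Wg).1|exact: (WU _ Wh).2].
rewrite pactM /=; transitivity (cutoff (pact g S) K).
  apply: cutoff_sub PS; try exact: metric_compact_closed; exact: subsetUl.
apply: (cutoff_pact _ cK' _ SQ); first exact: metric_compact_closed.
by move=> x Kx; right; exists g => //; exists x.
Qed.

(* The uniform structure depends on the action of G, hence a copy of the
   carrier keyed on the group pattern space. *)
Definition local_matching : Type := pattern Pi.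

HB.instance Definition _ := Choice.on local_matching.

HB.instance Definition _ := @isUniform.Build local_matching match_entourage
  match_entourage_filter match_entourage_diagonal match_entourage_inv
  match_entourage_split.

Lemma local_matching_entourageE :
  @entourage local_matching = match_entourage.
Proof. by []. Qed.

Definition pattern_orbit (P : Pi) : set Pi := [set pact g P | g in [set: G]].

Definition hull (P : Pi) : set local_matching :=
  closure (pattern_orbit P : set local_matching).

Definition flc (P : Pi) : Prop :=
  forall K : set X, compact K ->
    exists2 F : set Pi, finite_set F &
      [set cutoff (pact g P) K | g in [set: G]] `<=` \bigcup_(Q in F) pattern_orbit Q.

End local_matching.

(* Main.v *)
(* The hull is totally bounded and the local matching uniformity is complete.
   Total boundedness: by FLC each [(g P) /\ K] lies in one of finitely many
   orbits; two patterns of an orbit with nonempty supports inside [K] differ by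
   an element of [{g | g K meets K}], which is compact by properness and hence
   covered by finitely many translates of a small ball around 1. Glueability
   for the empty family makes the pattern with empty support unique.
   Completeness: a Cauchy filter yields patterns [P_n] with
   [P_n /\ K_n = (g_n P_(n+1)) /\ K_n], [g_n] within [2^-n] of 1 and [K_n]
   exhausting [X]. The products [s_n = g_0 ... g_(n-1)] converge to some [l],
   the patterns [s_n P_n] agree on the growing sets [s_n K_n], so they glue to
   a pattern [S'], and [l^-1 S'] is the limit of the filter. *)

Require Import Defs.
From HB Require Import structures.
From mathcomp Require Import all_boot all_order all_algebra.
From mathcomp Require Import all_classical all_reals all_analysis.
From mathcomp Require Import finmap lra.
Set Implicit Arguments.
Unset Strict Implicit.
Unset Printing Implicit Defensive.

Import Order.TTheory GRing.Theory Num.Theory.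

Local Open Scope classical_set_scope.
Local Open Scope ring_scope.

(** * Compactness, nets and ultrafilters *)

Lemma compact_cover_compact (T : topologicalType) (A : set T) :
  compact A = cover_compact A.
Proof.
(* The case split supplies a base point, since [compact_cover] is stated for pointed spaces. *)
have [->|/set0P[x0 _]] := eqVneq A set0.
  by rewrite propeqE; split=> _ //; [move=> I D f _ _; exists fset0|exact: compact0].
pose pT : ptopologicalType := HB.pack T (isPointed.Build T x0).
exact: (congr1 (@^~ A) (@compact_cover pT)).
Qed.

Lemma compact_finite_net (R : realType) (T : metricType R) (A : set T) (e : R) :
  compact A -> 0 < e ->
  exists2 D : set T, finite_set D &
    forall x, A x -> exists2 y, D y & mdist y x < e.
Proof.
rewrite compact_cover_compact => cA e0.
have [|x Ax|D _ AD] := cA T A (fun x => (ball x e)^°).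
- by move=> x _; exact: open_interior.
- by exists x => //; apply: nbhsx_ballx.
- exists [set` D]; first exact: finite_fset.
  move=> x /AD[y Dy /interior_subset]; rewrite ballEmdist => xy.
  by exists y.
Qed.

Lemma compact_sub_cball (R : realType) (T : metricType R) (A : set T) (x0 : T) :
  compact A -> exists r : R, A `<=` cball x0 r.
Proof.
move=> /compact_near_coveringP cA.
have [x Ax|r [_ Ar]] := cA _ +oo (fun (r : R) x => mdist x0 x <= r)
    (@filter_filter R _ proper_pinfty_nbhs); last first.
  by exists (r + 1) => x Ax; apply: Ar => //; rewrite ltrDl.
exists (ball x 1, [set r | mdist x0 x + 1 < r]) => /=.
  by split; [apply: nbhsx_ballx|apply: nbhs_pinfty_gt; exact: num_real].
move=> [y r] /= []; rewrite ballEmdist /= => xy xr.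
by have := metric_triangle x0 x y; lra.
Qed.

(** Every tail of [u] stays in a compact ball, so a cluster point of [u] exists and lies in all
    these balls. *)
Lemma geometric_cvg (R : realType) (T : properMetricType R) (u : nat -> T) :
  (forall n, mdist (u n) (u n.+1) <= 2^-1 ^+ n) ->
  exists l, forall n, mdist (u n) l <= 2 * 2^-1 ^+ n.
Proof.
move=> uS.
(* Exact partial sum of the geometric series; the subtracted term lets the induction close. *)
have uD n k : mdist (u n) (u (n + k)%N) <= 2 * 2^-1 ^+ n - 2 * 2^-1 ^+ (n + k).
  elim: k => [|k IH]; first by rewrite addn0 mdistxx subrr.
  have := metric_triangle (u n) (u (n + k)%N) (u (n + k).+1).
  by rewrite addnS; have := uS (n + k)%N; rewrite exprS; lra.
have tail n : \forall m \near \oo, cball (u n) (2 * 2^-1 ^+ n) (u m).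
  exists n => // m /= /subnKC <-; apply: le_trans (uD _ _) _.
  by rewrite gerBl mulr_ge0 // exprn_ge0 // invr_ge0.
have [l [_ ul]] := @cball_compact _ T (u 0%N) (2 * 2^-1 ^+ 0) (u @ \oo) _ (tail 0%N).
exists l => n; apply: (metric_compact_closed (cball_compact (u n) (2 * 2^-1 ^+ n))).
by move=> B lB; exact: ul (tail n) lB.
Qed.

(** Otherwise [F] contains every complement, hence their finite intersection, which misses the
    union. *)
Lemma ultra_bigcup (T : Type) (I : choiceType) (F : set_system T) (D : set I)
    (f : I -> set T) :
  UltraFilter F -> finite_set D -> F (\bigcup_(i in D) f i) ->
  exists2 i, D i & F (f i).
Proof.
move=> FU /finite_fsetP[{}D ->] FD; apply: contrapT => noF.
have FC : F (\bigcap_(i in [set` D]) ~` f i).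
  apply: filter_bigI => i Di.
  by have [Ffi|//] := in_ultra_setVsetC (f i) FU; case: noF; exists i.
apply: (@filter_not_empty _ F).
by rewrite -(setICr (\bigcup_(i in [set` D]) f i)) setC_bigcup; exact: filterI.
Qed.

(** A finite net covers [A] by finitely many small sections; the ultrafilter selects one of them. *)
Lemma totally_bounded_ultra_cauchy (T : uniformType) (A : set T)
    (F : set_system T) : UltraFilter F -> F A ->
  (forall E, entourage E -> exists2 D : set T, finite_set D &
    forall x, A x -> exists2 y, D y & E (x, y)) ->
  cauchy F.
Proof.
move=> FU FA tbA E entE.
pose B := split_ent E `&` (split_ent E)^-1%relation.
have entB : entourage B by apply: filterI => //; exact: entourage_inv.
have [D finD AD] := tbA _ entB.
have [|y Dy Fy] := @ultra_bigcup _ _ F D (fun y => [set x | B (x, y)]) FU finD.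
  by apply: filterS FA => x /AD[y Dy Bxy]; exists y.
exists ([set x | B (x, y)], [set x | B (x, y)]) => //.
move=> [x z] /= [[xy _] [_ yz]]; exact: (entourage_split y).
Qed.

(** * Cut-offs, order and gluing *)

Lemma cutoff_le (R : realType) (X : metricType R) (Pi : pattern_space X)
    (P : Pi) (C : set X) : closed C -> (cutoff P C <= P)%O.
Proof.
move=> cC; apply/pattern_leE.
have sC : supp (cutoff P C) `<=` C.
  by apply/cutoff_suppP => //; rewrite cutoffI // setIid.
rewrite -{1}(setIidr sC) -cutoffI //; last exact: supp_closed.
exact: cutoff_supp.
Qed.

Lemma supremums_max d (T : porderType d) (A : set T) (x y : T) :
  supremums A x -> A y -> ubound A y -> x = y.
Proof. by move=> [Ax xA] Ay yA; apply/le_anti; rewrite Ax // xA. Qed.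

(** The truncations [T n] form a chain, hence are pairwise compatible. On a ball inside [D n] all
    [T m] with [m >= n] agree, hence local finiteness. *)
Lemma glue_exhaustion (R : realType) (X : properMetricType R)
    (Pi : pattern_space X) (Q : nat -> Pi) (D : nat -> set X) :
  glueable Pi -> (forall n, closed (D n)) ->
  (forall n, D n `<=` D n.+1) -> (forall x r, exists n, cball x r `<=` D n) ->
  (forall n, cutoff (Q n.+1) (D n) = cutoff (Q n) (D n)) ->
  exists S : Pi, forall n, cutoff S (D n) = cutoff (Q n) (D n).
Proof.
move=> glue cD DS exhD QS.
have DD n k : D n `<=` D (n + k)%N.
  by elim: k => [|k IH]; rewrite ?addn0 // addnS; exact: subset_trans (DS _).
have QD n k : cutoff (Q (n + k)%N) (D n) = cutoff (Q n) (D n).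
  elim: k => [|k <-]; first by rewrite addn0.
  by rewrite addnS -(setIidr (DD n k)) -!cutoffI // QS.
pose T n := cutoff (Q n) (D n).
have TD n m : (n <= m)%N -> cutoff (T m) (D n) = T n.
  by move=> /subnKC <-; rewrite cutoffI // (setIidr (DD _ _)) QD.
have TT n m : (n <= m)%N -> (T n <= T m)%O.
  by move=> nm; rewrite -(TD _ _ nm); exact: cutoff_le.
have [||S _ SD] := glue (range T).
- move=> x r _; have [n xrD] := exhD x r.
  apply: (@sub_finite_set _ _ ((fun k => cutoff (T k) (cball x r)) @` `I_n.+1));
    last exact/finite_image/finite_II.
  move=> _ [_ [m _ <-] <-]; have [mn|nm] := ltnP m n.
    by exists m => //=; exact: ltnW.
  have cB : closed (cball x r) := metric_compact_closed (cball_compact x r).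
  exists n => //=.
  by rewrite -(TD _ _ nm) cutoffI // (setIidr xrD).
- move=> _ _ [n _ <-] [m _ <-]; exists (T (maxn n m)).
  by split; apply: TT; rewrite ?leq_maxl ?leq_maxr.
(* [T n] is the greatest element of the family cut off at [D n], hence its supremum. *)
- exists S => n; apply: (supremums_max (SD _ (cD n))).
    by exists (T n); [exists n|exact: TD].
  move=> _ [_ [m _ <-] <-]; have [nm|mn] := leqP n m; first by rewrite TD.
  exact: le_trans (cutoff_le _ (cD n)) (TT _ _ (ltnW mn)).
Qed.

(** The supremum of the empty family is a least pattern, and a pattern with empty support, fixed by
    every cut-off, equals anything below it. *)
Lemma glueable_supp0_unique (R : realType) (X : metricType R)
    (Pi : pattern_space X) (P Q : Pi) :
  glueable Pi -> supp P `<=` set0 -> supp Q `<=` set0 -> P = Q.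
Proof.
move=> glue P0 Q0.
have [||S [_ Smin] _] := glue set0.
- by move=> x r _; rewrite /set_cutoff image_set0; exact: finite_set0.
- by move=> ? ? [].
have S_le T : (S <= T)%O by apply: Smin => ? [].
have S_eq T : supp T `<=` set0 -> S = T.
  move=> T0; have /pattern_leE <- := S_le T; apply/cutoff_suppP.
    exact: supp_closed.
  exact: subset_trans (@sub0set _ _).
by rewrite -(S_eq P) ?(S_eq Q).
Qed.

(** * Group actions on patterns and total boundedness of the hull *)

Section action.
Context (R : realType) (G : properMetricGroupType R) (X : properMetricType R).
Context (a : isometric_action G X).

Lemma actK (g : G) : cancel (a g) (a g^-1%g).
Proof. by move=> x; rewrite -actM mulVg act1. Qed.

Lemma actKV (g : G) : cancel (a g^-1%g) (a g).
Proof. by move=> x; rewrite -actM mulgV act1. Qed.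

Lemma compact_act_image (V : set G) (K : set X) :
  compact V -> compact K -> compact [set a g x | g in V & x in K].
Proof.
move=> cV cK.
have -> : [set a g x | g in V & x in K] =
    (fun gx : G * X => a gx.1 gx.2) @` (V `*` K).
  apply/seteqP; split=> [_ [g Vg [x Kx <-]]|_ [[g x] [/= Vg Kx] <-]].
    by exists (g, x).
  by exists g => //; exists x.
apply: continuous_compact; last exact: compact_setX.
exact/continuous_subspaceT/act_continuous.
Qed.

Lemma compact_act (g : G) (K : set X) : compact K -> compact (a g @` K).
Proof.
have -> : a g @` K = [set a h x | h in [set g] & x in K].
  apply/seteqP; split=> [_ [x Kx <-]|_ [_ -> [x Kx <-]]]; last by exists x.
  by exists g => //; exists x.
exact/compact_act_image/compact_set1.
Qed.

(** This return set is the projection to [G] of the preimage of a compact square under the proper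
    map. *)
Lemma proper_action_return_compact (K : set X) : proper_action a -> compact K ->
  compact [set g | exists2 x, K x & K (a g x)].
Proof.
move=> pa cK.
have -> : [set g | exists2 x, K x & K (a g x)] =
    fst @` ((fun gx : G * X => (a gx.1 gx.2, gx.2)) @^-1` (K `*` K)).
  apply/seteqP; split=> [g [x Kx Kgx]|_ [[g x] [/= Kgx Kx] <-]]; last by exists x.
  by exists (g, x).
apply: continuous_compact; last by apply: pa; exact: compact_setX.
by apply: continuous_subspaceT => gx; exact: cvg_fst.
Qed.

Context (Pi : group_pattern_space a).
Local Notation L := (local_matching Pi).

Lemma pactK (g : G) : cancel (@pact _ _ _ _ Pi g) (pact g^-1%g).
Proof. by move=> P; rewrite -pactM mulVg pact1. Qed.

Lemma pactKV (g : G) : cancel (@pact _ _ _ _ Pi g^-1%g) (pact g).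
Proof. by move=> P; rewrite -pactM mulgV pact1. Qed.

Lemma supp_pact_sub (g : G) (P : Pi) (K : set X) : compact K ->
  supp P `<=` K -> supp (pact g P) `<=` a g @` K.
Proof.
move=> cK sK; have cK' := metric_compact_closed cK.
apply/cutoff_suppP; first by apply: metric_compact_closed; exact: compact_act.
by rewrite [LHS]pact_cutoff // (iffRL (cutoff_suppP _ cK') sK).
Qed.

(** If [h] and [g] both carry the support of [Q] into [K], then [h * g^-1] sends a point of [K] into
    [K], so it lies in a compact return set, which has a finite net. *)
Lemma orbit_finite_net (Q : Pi) (K : set X) (e : R) :
  glueable Pi -> proper_action a -> compact K -> 0 < e ->
  exists2 F : set Pi, finite_set F & forall P, pattern_orbit Q P ->
    supp P `<=` K -> exists2 T, F T & exists2 g, mdist 1%g g < e & P = pact g T.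
Proof.
move=> glue pa cK e0.
(* An empty support offers no point to track, but then every translate of [Q] equals [Q]. *)
have [Q0|/set0P[z Qz]] := eqVneq (supp Q) set0.
  exists [set Q]; first exact: finite_set1.
  move=> _ [g _ <-] _; exists Q => //; exists 1%g; first by rewrite mdistxx.
  rewrite pact1; apply: glueable_supp0_unique glue _ _; last by rewrite Q0.
  by rewrite -(image_set0 (a g)); apply: supp_pact_sub; rewrite ?Q0; [exact: compact0|].
have [[h sK]|noh] := pselect (exists h, supp (pact h Q) `<=` K); last first.
  exists set0; first exact: finite_set0.
  by move=> _ [g _ <-] sK; case: noh; exists g.
have [D finD MD] := compact_finite_net (proper_action_return_compact pa cK) e0.
exists [set pact (g^-1 * h)%g Q | g in D]; first exact: finite_image.
move=> _ [g _ <-] gK.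
have supp_in k : supp (pact k Q) `<=` K -> K (a k z).
  move=> /(supp_pact_sub (g := k^-1%g) cK); rewrite pactK => /(_ z Qz)[y Ky <-].
  by rewrite actKV.
have [|d Dd dk] := MD (h * g^-1)%g.
  by exists (a g z); [exact: supp_in|rewrite actM actK; exact: supp_in].
exists (pact (d^-1 * h)%g Q); first by exists d.
(* By left invariance this element is as close to 1 as [d] is to [h * g^-1]. *)
exists (g * h^-1 * d)%g; last by rewrite -pactM -!mulgA mulVKg mulVg mulg1.
rewrite metric_sym -(mdist_mull (h / g)%g) mulg1.
by rewrite -!mulgA mulKg mulVKg.
Qed.

Lemma match_on_entourage (K : set X) (e : R) :
  compact K -> 0 < e -> entourage (match_on K (cball 1%g e) : set (L * L)).
Proof.
move=> cK e0; exists (K, cball 1%g e) => //=; split=> //.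
split; first exact: cball_compact.
by apply/nbhs_ballP; exists e => // x; rewrite ballEmdist => /ltW.
Qed.

(** FLC leaves finitely many orbits for the cut-offs at [K], each with a finite net. The net need
    not lie in the orbit of [P]. *)
Lemma orbit_totally_bounded (P : Pi) (E : set (L * L)) :
  glueable Pi -> proper_action a -> flc P -> entourage E ->
  exists2 D : set L, finite_set D &
    forall Q, pattern_orbit P Q -> exists2 T, D T & E (Q, T).
Proof.
move=> glue pa flcP [[K V] /= [cK [cV nV]] KVE].
have cK' := metric_compact_closed cK.
have /nbhs_ballP[e /= e0 eV] := nV.
have [F finF PF] := flcP K cK.
have /choice[D /all_and2[finD QD]] (Q : Pi) : exists D : set Pi, finite_set D /\
    forall S, pattern_orbit Q S -> supp S `<=` K ->
      exists2 T, D T & exists2 g, mdist 1%g g < e & S = pact g T.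
  by have [D] := orbit_finite_net Q glue pa cK e0; exists D.
exists (\bigcup_(Q in F) D Q); first exact: bigcup_finite.
move=> _ [g _ <-].
have [|Q FQ QgP] := PF (cutoff (pact g P) K); first by exists g.
have [|T DT [h he PT]] := QD Q _ QgP.
  by apply/cutoff_suppP => //; rewrite cutoffI // setIid.
exists T; first by exists Q.
apply: KVE; exists h => /=; first by apply: eV; rewrite ballEmdist.
by rewrite -PT cutoffI // setIid.
Qed.

Lemma hull_totally_bounded (P : Pi) (E : set (L * L)) :
  glueable Pi -> proper_action a -> flc P -> entourage E ->
  exists2 D : set L, finite_set D &
    forall Q, hull P Q -> exists2 T, D T & E (Q, T).
Proof.
move=> glue pa flcP entE.
have [D finD PD] := orbit_totally_bounded glue pa flcP (entourage_split_ent entE).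
exists D => // Q PQ.
have [S [/PD[T DT ST] QS]] := PQ _ (nbhs_entourage Q (entourage_split_ent entE)).
exists T => //; apply: (entourage_split S) => //; exact/xsectionP.
Qed.

(** * Completeness of the local matching uniformity *)

(** The step [c] will absorb the displacement of [x0] by group elements; the factor 2 is the
    geometric tail from [geometric_cvg]. *)
Lemma match_entourage_base (x0 : X) (c : R) (E : set (L * L)) :
  1 <= c -> entourage E -> exists n : nat,
    match_on (cball x0 (n%:R * c)) (cball 1%g (2 * 2^-1 ^+ n)) `<=` E.
Proof.
move=> c1 [[K V] /= [cK [cV nV]] KVE].
have /nbhs_ballP[e /= e0 eV] := nV.
have [r Kr] := compact_sub_cball x0 cK.
have e20 : 0 < e / 2 by rewrite divr_gt0.
near \oo => n; exists n; apply: subset_trans KVE; apply: match_onS.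
- exact: metric_compact_closed.
- by apply: metric_compact_closed; exact: cball_compact.
- move=> x /Kr /= /le_trans; apply.
  have rn : r <= n%:R by near: n; exact: nbhs_infty_ger.
  by apply: (le_trans rn); rewrite ler_peMr.
- move=> g /= gn; apply: eV; rewrite ballEmdist /=; apply: le_lt_trans gn _.
  rewrite mulrC -ltr_pdivlMr // exprVn -div1r.
  by near: n; exact: (near_infty_natSinv_expn_lt (PosNum e20)).
Unshelve. all: by end_near. Qed.

Lemma local_matching_complete (x0 : X) (F : set_system L) :
  glueable Pi -> ProperFilter F -> cauchy F ->
  exists S : L, F --> S.
Proof.
move=> glue FF cF.
(* All [s n] below stay within 4 of 1, namely 2 from 1 to [l] plus 2 from [l] to [s n]; [c0] bounds
   how far such elements move [x0]. *)
have [c0 c0P] := compact_sub_cball x0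
  (compact_act_image (@cball_compact _ G 1%g 4) (@compact_set1 _ x0)).
pose c := Num.max 1 c0.
have c1 : 1 <= c by rewrite le_max lexx.
have cP g : mdist 1%g g <= 4 -> mdist x0 (a g x0) <= c.
  move=> g4; rewrite le_max; apply/orP; right; apply: c0P.
  by exists g => //; exists x0.
pose K n := cball x0 (n%:R * c).
have cK n : compact (K n) by exact: cball_compact.
have clK n : closed (K n) by exact: metric_compact_closed.
have /choice[A /all_and2[FA AE]] (n : nat) : exists A, F A /\
    forall p q, A p -> A q -> match_on (K n) (cball 1%g (2^-1 ^+ n)) (p, q).
  have [|[A B] [/= FA FB] AB] := cF (match_on (K n) (cball 1%g (2^-1 ^+ n))).
    by apply: match_on_entourage; rewrite ?exprn_gt0 ?invr_gt0.
  exists (A `&` B); split; first exact: filterI.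
  by move=> p q [Ap _] [_ Bq]; exact: (AB (p, q)).
(* Membership in [A n.-1] as well puts [p n] and [p n.+1] both in [A n]. *)
have /choice[p pA] (n : nat) : exists p, (A n `&` A n.-1) p.
  by apply: (@filter_ex _ F); exact: filterI.
have /choice[g /all_and2[gn pg]] (n : nat) : exists g,
    mdist 1%g g <= 2^-1 ^+ n /\
    cutoff (p n) (K n) = cutoff (pact g (p n.+1)) (K n).
  have [g gn pg] := AE n _ _ (pA n).1 (pA n.+1).2.
  by exists g.
pose s := fix s n := if n is m.+1 then (s m * g m)%g else 1%g.
have [l sl] : exists l, forall n, mdist (s n) l <= 2 * 2^-1 ^+ n.
  apply: geometric_cvg => n.
  by rewrite -[X in mdist X _]mulg1 mdist_mull.
have s4 n : mdist 1%g (s n) <= 4.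
  have := sl n; have := sl 0%N; have := metric_triangle 1%g l (s n).
  have : 2^-1 ^+ n <= 1 :> R by rewrite exprn_ile1 ?invr_ge0 ?invf_le1 ?ler1n.
  by rewrite (metric_sym l) expr0 /=; lra.
have clD n : closed (a (s n) @` K n).
  by apply: metric_compact_closed; exact: compact_act.
have [|||S' S'D] := @glue_exhaustion _ _ Pi (fun n => pact (s n) (p n))
  (fun n => a (s n) @` K n) glue clD.
(* [g n] moves [x0] by at most [c], exactly the growth of the radius from [K n] to [K n.+1]. *)
- move=> n _ [x Kx <-]; exists (a (g n)^-1%g x); last by rewrite actM actKV.
  rewrite /K /cball /= -(act_isometry a (g n)) actKV.
  have gn4 : mdist 1%g (g n) <= 4.
    apply: le_trans (gn n) _; apply: (@le_trans _ _ 1); last by rewrite ler1n.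
    by rewrite exprn_ile1 ?invr_ge0 ?invf_le1 ?ler1n.
  have := metric_triangle (a (g n) x0) x0 x.
  have := cP _ gn4; rewrite (metric_sym x0 (a _ _)).
  move: Kx; rewrite /K /cball /= -(natr1 n) mulrDl mul1r.
  by lra.
(* [s n] moves [x0] by at most [c], so its translate of [K n] contains the ball around [x0] of
   radius [n%:R * c - c]. *)
- move=> x r.
  near \oo => n; exists n => y /= xy; exists (a (s n)^-1%g y); last exact: actKV.
  rewrite /K /cball /= -(act_isometry a (s n)) actKV.
  have nc : n%:R <= n%:R * c by rewrite ler_peMr.
  have : c + mdist x0 x + r <= n%:R by near: n; exact: nbhs_infty_ger.
  have := cP (s n) (s4 n); rewrite (metric_sym x0 (a _ _)).
  have := metric_triangle (a (s n) x0) x0 y.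
  by have := metric_triangle x0 x y; have : mdist x y <= r := xy; lra.
- by move=> n /=; rewrite pactM !pact_cutoff // pg.
pose S := pact l^-1%g S'.
(* [(s n)^-1 * l] is within the geometric tail of 1 and sends [S] to [pact (s n)^-1 S'], which
   agrees with [p n] on [K n]. *)
have pS n : match_on (K n) (cball 1%g (2 * 2^-1 ^+ n)) (p n, S).
  exists ((s n)^-1 * l)%g.
    by rewrite /cball /= -(mdist_mull (s n)) mulg1 mulVKg.
  rewrite /S -pactM mulgK /=; apply: (can_inj (pactK (s n))).
  by rewrite -!pact_cutoff // pactKV S'D.
exists S => E; rewrite -nbhs_entourageE => -[B entB BE].
have entC : entourage (split_ent B `&` (split_ent B)^-1%relation).
  by apply: filterI => //; exact: entourage_inv.
have [n nC] := match_entourage_base x0 c1 entC.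
(* Both [S] and any [q] in [A n] match [p n], so they are close to each other through [p n]. *)
apply: filterS (FA n) => q Aq; apply: BE; apply/xsectionP.
apply: (entourage_split (p n)) => //; first by have [] := nC _ (pS n).
suff /nC[] : match_on (K n) (cball 1%g (2 * 2^-1 ^+ n)) (p n, q) by [].
apply: match_onS (AE n _ _ (pA n).1 Aq) => // h /= /le_trans; apply.
by rewrite ler_peMl ?ler1n // exprn_ge0 // invr_ge0.
Unshelve. all: by end_near. Qed.
End action.

Theorem theorem3p25 (R : realType) (G : properMetricGroupType R)
    (X : properMetricType R) (X_nonempty : [set: X] !=set0)
    (a : isometric_action G X) (Pi : group_pattern_space a)
    (Pi_glueable : glueable Pi) (a_proper : proper_action a)
    (P : Pi) (P_flc : flc P) :
  cover_compact (hull P).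
Proof.
have [x0 _] := X_nonempty.
rewrite -compact_cover_compact compact_ultra => F FU FP.
have cF : cauchy F.
  apply: totally_bounded_ultra_cauchy FP _ => E.
  exact: hull_totally_bounded.
have [S FS] := local_matching_complete x0 Pi_glueable (@ultra_proper _ _ FU) cF.
(* Each neighbourhood of [S] belongs to [F], as does the hull, so they meet; the hull is closed,
   hence contains [S]. *)
exists S; split=> //; apply: closed_closure => B /FS FB.
by apply: (@filter_ex _ F); exact: filterI.
Qed.
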